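(* Let $h\ge 1$ be an integer and let $(d;a)=(d_1,\ldots,d_c;a_0,\ldots,a_n)$ be an $h$-regular pair such that $c\leq 3$, $c\leq n$ and $a_i\nmid h$ for all $0\leq i\leq n$. Then $$\delta(d;a)\geq F^h(a_0,\ldots,a_n).$$
   Context: A pair $(d;a)=(d_1,\ldots,d_c;a_0,\ldots,a_n)$ consists of two tuples of positive integers, the degrees $d_i$ and the weights $a_j$. For a positive integer $h$, the pair is $h$-regular if for every non-empty subset $I=\{i_1,\ldots,i_k\}\subset\{0,\ldots,n\}$ (with $k$ elements) such that $a_I:=\gcd(a_{i_1},\ldots,a_{i_k})>1$, at least one of the following holds: (i) there exist $k$ distinct indices $p_1,\ldots,p_k\in\{1,\ldots,c\}$ such that $a_I$ divides each of $d_{p_1},\ldots,d_{p_k}$; (ii) $a_I\mid h$. The amplitude of the pair is $\delta(d;a)=\sum_{i=1}^c d_i-\sum_{j=0}^n a_j$. For positive integers $m_1,\ldots,m_k$ with $\gcd(m_1,\ldots,m_k)=1$, let $S=\langle m_1,\ldots,m_k\rangle$ be the set of their non-negative integer linear combinations. For $h\geq 1$, $F^h(m_1,\ldots,m_k)=\max\big(h\mathbb{Z}\setminus(h\mathbb{Z}\cap S)\big)$, the largest multiple of $h$ not in $S$ (it equals $-h$ if some $m_i$ divides $h$). If $g=\gcd(m_1,\ldots,m_k)>1$, then by convention $F^h(m_1,\ldots,m_k)=g\,F^{h/G}(m_1/g,\ldots,m_k/g)$ with $G=\gcd(g,h)$. *)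

(* Defs.v *)
From mathcomp Require Import all_boot all_order all_algebra.
From mathcomp Require Import boolp classical_sets.

Set Implicit Arguments.
Unset Strict Implicit.
Unset Printing Implicit Defensive.
Import Order.TTheory GRing.Theory Num.Theory.
Local Open Scope classical_set_scope.
Local Open Scope ring_scope.

Definition gcd_on k (m : 'I_k -> nat) (I : {set 'I_k}) : nat :=
  \big[gcdn/0%N]_(i in I) m i.

Definition gcd_all k (m : 'I_k -> nat) : nat := \big[gcdn/0%N]_(i < k) m i.

Definition regular (h : nat) c n (d : 'I_c -> nat) (a : 'I_n.+1 -> nat) : Prop :=
  forall I : {set 'I_n.+1}, I != finset.set0 -> (1 < gcd_on a I)%N ->
    (exists p : 'I_#|I| -> 'I_c,
        injective p /\ forall j, (gcd_on a I %| d (p j))%N)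
    \/ (gcd_on a I %| h)%N.

Definition amplitude c n (d : 'I_c -> nat) (a : 'I_n.+1 -> nat) : int :=
  \sum_(i < c) (d i)%:Z - \sum_(j < n.+1) (a j)%:Z.

Definition semigroup k (m : 'I_k -> nat) : set int :=
  [set x | exists l : 'I_k -> nat, x = \sum_(i < k) (l i)%:Z * (m i)%:Z].

(* The greatest element of A, and the junk value 0 if there is none. *)
Definition max_int (A : set int) : int := xget 0 (A `&` ubound A).

Definition frobenius_gaps (h : nat) k (m : 'I_k -> nat) : set int :=
  [set x | (h%:Z %| x)%Z] `\` semigroup m.

(* For g = 1 this is the greatest multiple of h outside the semigroup, by
   [frobenius_coprime] and [frobenius_gaps_max]; for g > 1 it is the
   convention F^h(m) = g F^(h/G)(m/g) with G = gcd(g, h), where the maximum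
   again exists since the m i / g are coprime, by [gcd_all_div]. *)
Definition frobenius (h : nat) k (m : 'I_k -> nat) : int :=
  let g := gcd_all m in
  g%:Z * max_int (frobenius_gaps (h %/ gcdn g h) (fun i => m i %/ g)%N).

Lemma frobenius_coprime h k (m : 'I_k -> nat) :
  gcd_all m = 1%N -> frobenius h m = max_int (frobenius_gaps h m).
Proof.
rewrite /frobenius => ->; rewrite gcd1n divn1 mul1r.
by under [X in frobenius_gaps _ X]funext do rewrite divn1.
Qed.

Lemma gcd_all_div k (m : 'I_k -> nat) :
  (0 < gcd_all m)%N -> gcd_all (fun i => m i %/ gcd_all m)%N = 1%N.
Proof.
move=> g0; have gP i : (gcd_all m %| m i)%N.
  by rewrite /gcd_all (bigD1 i) //= dvdn_gcdl.
set g' := gcd_all _.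
have g'P i : (g' %| m i %/ gcd_all m)%N.
  by rewrite /g' {1}/gcd_all (bigD1 i) //= dvdn_gcdl.
have: (g' * gcd_all m %| gcd_all m)%N.
  rewrite [X in (_ %| X)%N]/gcd_all.
  elim/big_rec: _ => [|i x _ xP]; first exact: dvdn0.
  by rewrite dvdn_gcd xP -[m i](divnK (gP i)) dvdn_mul.
by rewrite -{2}[gcd_all m]mul1n dvdn_pmul2r // dvdn1 => /eqP.
Qed.

Lemma bezout_seq k (m : 'I_k -> nat) (r : seq 'I_k) : uniq r ->
  exists u : 'I_k -> int,
    \sum_(i <- r) u i * (m i)%:Z = (\big[gcdn/0%N]_(i <- r) m i)%:Z.
Proof.
elim: r => [|x r IH] /=; first by exists (fun=> 0); rewrite !big_nil.
move=> /andP[xr /IH[u Hu]].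
have [a [b Hab]] := Bezoutz (m x)%:Z (\big[gcdn/0%N]_(i <- r) m i)%:Z.
exists (fun i => if i == x then a else b * u i).
rewrite !big_cons eqxx.
rewrite (eq_big_seq (fun i => b * (u i * (m i)%:Z))).
  by rewrite -mulr_sumr Hu Hab.
move=> i ir; case: eqP => [e|_]; last by rewrite mulrA.
by rewrite -e ir in xr.
Qed.

Lemma semigroup_cofinite k (m : 'I_k -> nat) :
  gcd_all m = 1%N -> exists N : nat, forall x : int, N%:Z <= x -> semigroup m x.
Proof.
move=> m1.
have [i0 mi0] : exists i, (0 < m i)%N.
  apply/existsP; apply: contraPT m1 => /existsPn m0.
  rewrite /gcd_all big1 // => i _.
  by have := m0 i; rewrite lt0n negbK => /eqP.
have M0 : (m i0)%:Z != 0 by rewrite eqz_nat -lt0n.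
have [u Hu] := bezout_seq m (index_enum_uniq 'I_k).
have {}Hu : \sum_i u i * (m i)%:Z = 1 by rewrite Hu -/(gcd_all m) m1.
pose v i := `|(u i %% (m i0)%:Z)%Z|%N.
have vE i : (v i)%:Z = (u i %% (m i0)%:Z)%Z by rewrite /v gez0_abs // modz_ge0.
pose s := (\sum_i v i * m i)%N.
have sE : s%:Z = \sum_i (v i)%:Z * (m i)%:Z.
  by rewrite /s -natz natr_sum; apply: eq_bigr => i _; rewrite natz PoszM.
have Hs : ((m i0)%:Z %| 1 - s%:Z)%Z.
  rewrite sE -Hu -sumrB; apply: rpred_sum => i _.
  rewrite -mulrBl vE {1}(divz_eq (u i) (m i0)%:Z) addrK.
  by rewrite mulrAC dvdz_mull.
exists (m i0 * s)%N => x Nx.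
pose r := `|(x %% (m i0)%:Z)%Z|%N.
have rE : r%:Z = (x %% (m i0)%:Z)%Z by rewrite /r gez0_abs // modz_ge0.
have rM : (r <= m i0)%N.
  by apply: ltnW; rewrite -ltz_nat rE ltz_pmod // ltz_nat.
have : ((m i0)%:Z %| x - r%:Z * s%:Z)%Z.
  have -> : x - r%:Z * s%:Z = (x - r%:Z) + r%:Z * (1 - s%:Z).
    by rewrite mulrBr mulr1 addrA subrK.
  rewrite rpredD ?dvdz_mull // rE {1}(divz_eq x (m i0)%:Z) addrK.
  exact: dvdz_mull.
case/dvdzP => q Hq.
have q0 : 0 <= q.
  rewrite -(pmulr_lge0 (x := (m i0)%:Z)) ?ltz_nat // -Hq subr_ge0.
  by apply: le_trans Nx; rewrite -PoszM lez_nat leq_mul2r rM orbT.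
exists (fun i => r * v i + (if i == i0 then `|q| else 0))%N.
have -> : x = r%:Z * s%:Z + q * (m i0)%:Z by rewrite -Hq addrC subrK.
rewrite sE mulr_sumr.
have -> : q * (m i0)%:Z =
    \sum_i (if i == i0 then `|q|%N else 0%N)%:Z * (m i)%:Z.
  rewrite (bigD1 i0) //= eqxx gez0_abs // big1 ?addr0 //.
  by move=> i /negPf ->; rewrite mul0r.
by rewrite -big_split; apply: eq_bigr => i _ /=; rewrite PoszD PoszM mulrDl mulrA.
Qed.

(* The maximum defining F^h exists. *)
Lemma frobenius_gaps_max h k (m : 'I_k -> nat) :
  (0 < h)%N -> gcd_all m = 1%N ->
  (frobenius_gaps h m `&` ubound (frobenius_gaps h m))
    (max_int (frobenius_gaps h m)).
Proof.
move=> h0 m1; have [N HN] := semigroup_cofinite m1.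
pose A := frobenius_gaps h m.
have Alt x : A x -> x < N%:Z.
  by move=> [_ nS]; rewrite ltNge; apply/negP => /HN.
have Ah : A (- h%:Z).
  split; first by rewrite /= rpredN dvdzz.
  move=> [l E]; have : 0 <= - h%:Z :> int.
    by rewrite E sumr_ge0 // => i _; rewrite mulr_ge0.
  by rewrite oppr_ge0 lez_nat leqNgt h0.
pose P n := `[< A (n%:Z - h%:Z) >].
have P0 : exists n, P n by exists 0%N; apply/asboolP; rewrite sub0r.
have PN n : P n -> (n <= N + h)%N.
  by move=> /asboolP/Alt; rewrite ltrBlDr => /ltW; rewrite -PoszD lez_nat.
case: (ex_maxnP P0 PN) => n /asboolP An nmax.
rewrite /max_int -/A; apply: (@xgetPex _ 0 (A `&` ubound A)).
exists (n%:Z - h%:Z); split => // x Ax.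
have [xh|xh] := leP (- h%:Z) x; last first.
  by apply: (le_trans (ltW xh)); rewrite lerDr.
have xh0 : 0 <= x + h%:Z by rewrite -lerBlDr sub0r.
rewrite lerBrDr -(gez0_abs xh0) lez_nat; apply: nmax.
by apply/asboolP; rewrite gez0_abs // addrK.
Qed.

(* Main.v *)
Require Import Defs.
From mathcomp Require Import all_boot all_order all_algebra zify ring.
Import Order.TTheory GRing.Theory Num.Theory.

Set Implicit Arguments.
Unset Strict Implicit.
Unset Printing Implicit Defensive.

(** Since F^h(a) is the largest multiple of h outside the semigroup S of the
weights a (after division by their gcd, which regularity forces to divide h),
the claim is that every multiple x of h with x > delta lies in S, where delta
is the amplitude. Regularity enters only through the inequalities
A(m) <= D(m) for m not dividing h, where A(m) and D(m) count the multiples of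
m among the weights and among the degrees. The proof is an induction, first on
the number of degrees, then on the sum of all degrees, all weights and h, in
which every move replaces the pair by a smaller one.

When a prime p divides h, two moves are available. One divides x, h and all
multiples of p among the degrees and the weights by p; it is sound when the
degrees prime to p have a sum no larger than that of the weights prime to p.
Otherwise, throwing away everything prime to p lowers delta, and this is
allowed when A(p) > D(p). If neither applies, then p can be dropped from h,
or some multiple m of p dividing h has A(m) > D(m), and as there are at most
three degrees, one can throw away everything not divisible by m. This is
[covers_prime_dvd], and it reduces the theorem to h = 1.

For h = 1 there are three moves. In [covers_strip_modulo], a multiple of a
weight b prime to p is subtracted from x to make it divisible by p, and then
the multiples of p are divided by p; this settles the case of a prime dividing
all degrees. In [covers_drop], a weight b dividing a degree d1 is removed
together with d1, a multiple of b being subtracted from x to make it divisible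
by the part of d1 prime to b, which becomes the new h. In [covers_glue], d1 is
removed and two weights dividing it are replaced by their gcd. A move may
create weights that divide the new h; then [sumn_dominated], which says that
the amplitude is nonnegative when all weights are at least 2, gives a direct
representation of x by two coprime weights.

These moves suffice for at most two degrees. For three degrees without common
prime factor, every prime divides at most two degrees and at most two weights.
If no [covers_drop] applies, some degree d1 has two non-coprime weights k, l
that divide only d1, and a prime p common to k and l divides a single other
degree d2. Then [covers_strip_modulo] gives a lower bound on d3, which allows
d3 and most weights to be thrown away, keeping k, l and a third weight, unless
all pairs of weights are related in such a way that either [covers_glue]
applies or all weights divide d1 only; in the latter case two disjoint pairs
of non-coprime weights show that d1 is large ([covers_disjoint_edges]). *)

(** * The semigroup of the weights *)

Inductive generated (a : seq nat) : int -> Prop :=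
| generated0 : generated a 0
| generatedS b x : b \in a -> generated a x -> generated a (x + b%:Z)%R.

Lemma generatedD a x y : generated a x -> generated a y -> generated a (x + y)%R.
Proof.
move=> gx; elim=> [|b z ba _ IH]; first by rewrite addr0.
by rewrite addrA; apply: generatedS.
Qed.

Lemma generatedM a b l : b \in a -> generated a (Posz (l * b)).
Proof.
move=> ba; elim: l => [|l IH]; first exact: generated0.
by rewrite mulSn addnC PoszD; apply: generatedS.
Qed.

Lemma generated_mem a b : b \in a -> generated a (Posz b).
Proof. by rewrite -{2}[b]mul1n; apply: generatedM. Qed.

Lemma generated_scale c a a' x :
    (forall b, b \in a -> generated a' (Posz (c * b))) ->
  generated a x -> generated a' (c%:Z * x)%R.
Proof.
move=> Hb; elim=> [|b z ba _ IH]; first by rewrite mulr0; apply: generated0.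
by rewrite mulrDr -PoszM; apply: generatedD; [|apply: Hb].
Qed.

Lemma generated_sub a a' x :
  {subset a <= a'} -> generated a x -> generated a' x.
Proof.
move=> Ha; elim=> [|b z ba _ IH]; first exact: generated0.
by apply: generatedS; first exact: Ha.
Qed.

Lemma residue_coprime (b h : nat) (x : int) : 0 < h -> coprime b h ->
  exists2 l : nat, l < h & (h%:Z %| (x - (l * b)%N%:Z)%R)%Z.
Proof.
move=> h0 cop.
have [u [v uv]] := Bezoutz b h.
have {}uv : (u * b%:Z + v * h%:Z = 1)%R.
  by rewrite uv /gcdz !absz_nat (eqP cop).
have E := divz_eq (x * u)%R h; set q := (_ %/ _)%Z in E; set r := (_ %% _)%Z in E.
have r0 : (0 <= r)%R by rewrite modz_ge0; lia.
have rh : (r < h%:Z)%R by apply: ltz_pmod; lia.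
exists `|r|%N; first by lia.
rewrite PoszM gez0_abs //; apply/dvdzP; exists (x * v + q * b)%R.
have -> : r = (x * u - q * h)%R by rewrite E addrC addKr.
by rewrite -{1}[x]mulr1 -uv; ring.
Qed.

(** Sylvester: the Frobenius number of two coprime weights. *)
Lemma generated_two a b c (x : int) : b \in a -> c \in a -> 0 < c ->
  coprime b c -> ((b * c)%N%:Z - b%:Z - c%:Z < x)%R -> generated a x.
Proof.
move=> ba ca c0 cop bcx.
have [l lc /dvdzP[q Eq]] := residue_coprime x c0 cop.
have q0 : (0 <= q)%R by nia.
have -> : x = ((l * b)%N%:Z + (`|q| * c)%N%:Z)%R by lia.
by apply: generatedD; apply: generatedM.
Qed.

(** * Pairs of degrees and weights *)

Notation mults m s := (count (dvdn m) s).

Definition degree_gap (d a : seq nat) : int := ((sumn d)%:Z - (sumn a)%:Z)%R.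

Definition dominated h (d a : seq nat) := 
  forall m, ~~ (m %| h) -> mults m a <= mults m d.

(** Negative multiples of h are included, so that this entails
degree_gap d a >= - h. *)
Definition covers h d a := forall x : int,
  (h%:Z %| x)%Z -> (degree_gap d a < x)%R -> generated a x.

Record admissible h (d a : seq nat) : Prop := Admissible {
  adm_h : 0 < h;
  adm_d : all (leq 1) d;
  adm_a : all (leq 1) a;
  adm_dom : dominated h d a;
  adm_size : size d < size a;
  adm_ndvd : all (fun b => ~~ (b %| h)) a }.

Lemma admissible_perm h d d' a a' : perm_eq d d' -> perm_eq a a' ->
  admissible h d a -> admissible h d' a'.
Proof.
move=> pd pa [h0 d0 a0 dom sz nd]; split=> //.
- by rewrite -(perm_all _ pd).
- by rewrite -(perm_all _ pa).
- by move=> m /dom; rewrite (permP pd) (permP pa).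
- by rewrite -(perm_size pd) -(perm_size pa).
- by rewrite -(perm_all _ pa).
Qed.

Lemma covers_perm h d d' a a' : perm_eq d d' -> perm_eq a a' ->
  covers h d' a' -> covers h d a.
Proof.
move=> pd pa cov x hx; rewrite /degree_gap (perm_sumn pd) (perm_sumn pa).
move=> /cov -/(_ hx); apply: generated_sub => b.
by rewrite (perm_mem pa).
Qed.

(** Throwing away degrees and weights is a legitimate move as soon as it does
not raise the amplitude, since it can only shrink the semigroup. *)
Lemma covers_sub h d a d' a' : {subset a' <= a} ->
    (degree_gap d' a' <= degree_gap d a)%R -> covers h d' a' -> covers h d a.
Proof.
move=> sub le cov x hx ltx; apply: (generated_sub sub); apply: cov => //.
exact: le_lt_trans ltx.
Qed.

Lemma mults_mem m s : 0 < mults m s -> exists2 b, b \in s & m %| b.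
Proof. by rewrite -has_count => /hasP. Qed.

Lemma mults_gt0 m b s : b \in s -> m %| b -> 0 < mults m s.
Proof. by move=> bs mb; rewrite -has_count; apply/hasP; exists b. Qed.

Lemma leq_mults m m' s : m' %| m -> mults m s <= mults m' s.
Proof. by move=> mm; apply: sub_count => b; apply: dvdn_trans. Qed.

Definition strip p n := if p %| n then n %/ p else n.

(** This is why [strip] preserves domination: the number of multiples of m
after division by p is again a number of multiples, of an m' determined by m
alone. *)
Lemma mults_strip p m s : prime p ->
  mults m (map (strip p) s) = if p %| m then mults (p * m) s else mults m s.
Proof.
move=> pp; have p0 := prime_gt0 pp; rewrite count_map.
case: ifP => pm; apply: eq_count => b /=; rewrite /strip; case: ifP => pb.
- by rewrite -[in RHS](divnK pb) mulnC dvdn_pmul2r.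
- have nd k : p %| k -> (k %| b) = false.
    by move=> pk; apply: contraFF pb; apply: dvdn_trans.
  by rewrite !nd // dvdn_mulr.
- by rewrite -[in RHS](divnK pb) Gauss_dvdl // coprime_sym prime_coprime // pm.
- by [].
Qed.

Definition restrict m s := [seq b <- s | m %| b].

Lemma mults_restrict m m' s : mults m (restrict m' s) = mults (lcmn m m') s.
Proof. by rewrite count_filter; apply: eq_count => b; rewrite /= dvdn_lcm. Qed.

Lemma sumn_restrict m s :
  sumn s = sumn (restrict m s) + sumn [seq b <- s | ~~ (m %| b)].
Proof. by elim: s => //= b s ->; case: ifP => /= _; lia. Qed.

Lemma sumn_strip p s : prime p -> p * sumn (map (strip p) s) =
  sumn s + (p - 1) * sumn [seq b <- s | ~~ (p %| b)].
Proof.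
move=> /prime_gt0 p0; elim: s => [|b s IH] /=; first by lia.
rewrite mulnDr IH /strip; case: ifP => pb /=; last by nia.
by rewrite mulnC divnK //; lia.
Qed.

Lemma sumn_strip_le p s : prime p -> sumn (map (strip p) s) <= sumn s.
Proof.
move=> pp; elim: s => //= b s IH; apply: leq_add => //.
by rewrite /strip; case: ifP => // _; apply: leq_div.
Qed.

Lemma sumn_strip_lt p s : prime p -> all (leq 1) s -> 0 < mults p s ->
  sumn (map (strip p) s) < sumn s.
Proof.
move=> pp; have p1 := prime_gt1 pp; elim: s => //= b s IH /andP[b0 s0].
rewrite /strip; case: ifP => [pb _|_]; last first.
  by rewrite add0n => /(IH s0); rewrite /strip; lia.
have := sumn_strip_le s pp; rewrite /strip.
have : b %/ p < b by apply: ltn_Pdiv.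
lia.
Qed.

Lemma strip_gt0 p s : prime p -> all (leq 1) s -> all (leq 1) (map (strip p) s).
Proof.
move=> /prime_gt0 p0; rewrite all_map; apply: sub_all => b /= b0.
by rewrite /strip; case: ifP => // pb; rewrite divn_gt0 // dvdn_leq.
Qed.

Lemma generated_strip p a x : generated (map (strip p) a) x -> generated a (p%:Z * x)%R.
Proof.
apply: generated_scale => _ /mapP[b ba ->]; rewrite /strip; case: ifP => pb.
  by rewrite mulnC divnK //; apply: generated_mem.
exact: generatedM.
Qed.

(** * Nonnegativity of the amplitude *)

Lemma mults_strip_restrict p m s : 0 < p ->
  mults m (map (strip p) (restrict p s)) = mults (p * m) s.
Proof.
move=> p0; rewrite count_map count_filter; apply: eq_count => b /=.
rewrite /strip; case: ifP => pb.
  by rewrite andbT -[in RHS](divnK pb) mulnC dvdn_pmul2r.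
by rewrite andbF; apply/esym; apply: contraFF pb; apply: dvdn_trans; apply: dvdn_mulr.
Qed.

(** With u = 1 and v = -1 this is the sum of the entries larger than 1. The
family is closed under the differences taken in [weight_strip], which makes an
induction possible. *)
Definition weight (u v : int) s : int :=
  (u * (sumn s)%:Z + v * (count_mem 1 s)%:Z)%R.

Lemma weight_strip u v p s : prime p -> all (leq 1) s ->
  weight u v s = (weight u v (map (strip p) s) +
    weight ((p%:Z - 1) * u) (- v) (map (strip p) (restrict p s)))%R.
Proof.
rewrite /weight => pp; have p1 := prime_gt1 pp.
elim: s => [|b s IH] /=; first by lia.
move=> /andP[b0 /IH{}IH]; move: IH; rewrite /restrict /=.
have [pb|pb] /= := boolP (p %| b); last first.
  by rewrite [strip p b]/strip (negPf pb) !PoszD !mulrDr => E; lia.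
have -> : strip p b = b %/ p by rewrite /strip pb.
have bE : b = p * (b %/ p) by rewrite mulnC divnK.
have -> : (b == 1) = false.
  by apply/negbTE; apply: contraTN pb => /eqP->; rewrite dvdn1; lia.
rewrite {1}bE !PoszD PoszM; set C : int := Posz (b %/ p == 1).
set c : int := Posz (b %/ p); clearbody c C => E; nia.
Qed.

(** For fixed u and v, n |-> u n + v [n = 1] is a sum over the divisors m of n
of the coefficients u phi(m) + v mu(m), which are nonnegative for |v| <= u;
summing over the entries turns the inequality into A(m) <= D(m) for each m,
where m = 1 does not count if u + v = 0. Instead of using Moebius
inversion, the proof strips one prime after the other. *)
Lemma weight_le (d a : seq nat) (u v : int) : (`|v| <= u)%R ->
  all (leq 1) d -> all (leq 1) a ->
  (forall m, 1 < m -> mults m a <= mults m d) ->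
  (u + v = 0)%R \/ size a <= size d -> (weight u v a <= weight u v d)%R.
Proof.
have [N] := ubnP (sumn d); elim: N d a u v => // N IH d a u v dN uv d0 a0 dom sz.
have [d1|] := boolP (all (pred1 1) d).
  have a1 : all (pred1 1) a.
    apply/allP => b ba /=; have := allP a0 b ba; rewrite leq_eqVlt eq_sym.
    case/orP => // b1; have /mults_mem[c cd bc] : 0 < mults b d.
      by apply: leq_trans (dom b b1); apply: mults_gt0 ba _.
    by have /eqP c1 := allP d1 c cd; rewrite c1 dvdn1 in bc.
  have w1 s : all (pred1 1) s -> weight u v s = ((u + v) * (size s)%:Z)%R.
    move=> s1; rewrite /weight.
    have -> : count_mem 1 s = size s by apply/eqP; rewrite -all_count.
    have -> : sumn s = size s.
      by elim: s s1 => //= b s H /andP[/eqP-> /H->].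
    by ring.
  rewrite !w1 //; case: sz => [->|sz]; first by rewrite !mul0r.
  apply: ler_wpM2l; last by rewrite lez_nat.
  by have := ler_norm (- v)%R; rewrite normrN; lia.
case/allPn => b bd /= b1; have b0 := allP d0 b bd.
have pp : prime (pdiv b) by apply: pdiv_prime; lia.
have pb := pdiv_dvd b; set p := pdiv b in pp pb.
have p1 := prime_gt1 pp; have p0 := prime_gt0 pp.
have bp := mults_gt0 bd pb.
rewrite (weight_strip u v pp d0) (weight_strip u v pp a0); apply: lerD.
  apply: IH => //; try exact: strip_gt0.
  - by have := sumn_strip_lt pp d0 bp; lia.
  - move=> m m1; rewrite !mults_strip //; case: ifP => _; apply: dom => //.
    nia.
  - by rewrite !size_map.
have r0 s : all (leq 1) s -> all (leq 1) (restrict p s).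
  by move=> s0; rewrite all_filter; apply: sub_all s0 => c /= ->; rewrite implybT.
apply: IH => //; try exact/strip_gt0/r0.
- have := @sumn_strip_lt p (restrict p d) pp (r0 _ d0); rewrite mults_restrict (lcmn_idPr (dvdnn p)).
  by move=> /(_ bp); move: dN; rewrite (sumn_restrict p d); lia.
- rewrite normrN; have := normr_ge0 v; nia.
- by move=> m m1; rewrite !mults_strip_restrict //; apply: dom; nia.
- by right; rewrite !size_map !size_filter; apply: dom.
Qed.

(** Applied to pairs in which two coprime weights b and c are replaced by their
product, this puts x beyond the Frobenius number of b and c. *)
Lemma sumn_dominated d a : all (leq 1) d -> all (leq 2) a ->
  dominated 1 d a -> sumn a <= sumn d.
Proof.
move=> d0 a2 dom.
have a0 : all (leq 1) a by apply: sub_all a2 => b; lia.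
have := @weight_le d a 1%R (-1)%R _ d0 a0 _ _; rewrite /weight.
have -> : count_mem 1 a = 0.
  by apply/count_memPn/negP => /(allP a2).
move=> W; suff: ((1 * (sumn a)%:Z + -1 * 0%:Z) <= 1 * (sumn d)%:Z + -1 * (count_mem 1 d)%:Z)%R by lia.
by apply: W => //; [move=> m m1; apply: dom; rewrite dvdn1; lia|left].
Qed.

(** * Removing a prime divisor of h *)

Notation nonmults m s := [seq b <- s | ~~ (m %| b)].

Lemma sumn_nonmults_gt0 m s : all (leq 1) s ->
  (0 < sumn (nonmults m s)) = (mults m s < size s).
Proof.
elim: s => //= b s IH /andP[b0 /IH{}IH]; case: ifP => /=; last by rewrite IH; lia.
by have := count_size (dvdn m) s; case: (m %| b); lia.
Qed.

Lemma leq_sumn_nonmults m m' s : m' %| m ->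
  sumn (nonmults m' s) <= sumn (nonmults m s).
Proof.
move=> mm; elim: s => //= b s IH; case: (boolP (m' %| b)) => mb /=.
  by case: ifP => _ //=; apply: leq_trans IH (leq_addl _ _).
by rewrite (contraNN _ mb) /= ?leq_add2l // => /(dvdn_trans mm).
Qed.

Lemma eq_nonmults m m' s : m' %| m -> mults m s = mults m' s ->
  nonmults m s = nonmults m' s.
Proof.
move=> mm; elim: s => //= b s IH; have le := leq_mults s mm.
case: (boolP (m %| b)) => mb /=; first by rewrite (dvdn_trans mm mb) => -[/IH].
case: (boolP (m' %| b)) => mb' /= E; first by lia.
by rewrite IH.
Qed.

Lemma admissible_restrict h d a m : admissible h d a -> mults m d < mults m a ->
  admissible h (restrict m d) (restrict m a).
Proof.
move=> [h0 d0 a0 dom sz nd] lt.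
have filt (P : pred nat) s : all P s -> all P (restrict m s).
  by move=> s0; rewrite all_filter; apply: sub_all s0 => c /= ->; rewrite implybT.
split=> //; try exact: filt; last by rewrite !size_filter.
move=> k kh; rewrite !mults_restrict; apply: dom; apply: contraNN kh.
exact/dvdn_trans/dvdn_lcml.
Qed.

Lemma covers_restrict h d a m :
    sumn (nonmults m a) <= sumn (nonmults m d) ->
  covers h (restrict m d) (restrict m a) -> covers h d a.
Proof.
move=> le; apply: covers_sub; first by move=> b; rewrite mem_filter => /andP[].
by rewrite /degree_gap (sumn_restrict m d) (sumn_restrict m a); lia.
Qed.

Lemma admissible_strip h d a p : prime p -> p %| h -> admissible h d a ->
  admissible (h %/ p) (map (strip p) d) (map (strip p) a).
Proof.
move=> pp ph [h0 d0 a0 dom sz nd]; have p0 := prime_gt0 pp.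
split; try exact: strip_gt0.
- by rewrite divn_gt0 // dvdn_leq.
- move=> m mh; rewrite !mults_strip //; case: ifP => pm; apply: dom.
    by apply: contraNN mh; rewrite -{1}(divnK ph) mulnC dvdn_pmul2r.
  apply: contraNN mh; rewrite -{1}(divnK ph) Gauss_dvdl //.
  by rewrite coprime_sym prime_coprime // pm.
- by rewrite !size_map.
- rewrite all_map; apply: sub_all nd => b /=; apply: contraNN.
  rewrite /strip; case: ifP => pb; last by move/dvdn_trans; apply; apply: dvdn_div.
  by rewrite -{2}(divnK ph) -{2}(divnK pb) dvdn_pmul2r.
Qed.

(** As p divides h, it divides x, and nothing has to be subtracted from x. By
[sumn_strip], p times the new amplitude is the old one plus p - 1 times the
difference of the two sums of the hypothesis. *)
Lemma covers_strip h d a p : prime p -> p %| h ->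
    sumn (nonmults p d) <= sumn (nonmults p a) ->
    covers (h %/ p) (map (strip p) d) (map (strip p) a) ->
  covers h d a.
Proof.
move=> pp ph le cov x hx; rewrite /degree_gap => lt.
have p1 := prime_gt1 pp.
have /dvdzP[q qE] := hx; set y : int := (q * (h %/ p)%N%:Z)%R.
have xE : x = (p%:Z * y)%R by rewrite qE -{1}(divnK ph) PoszM /y; ring.
rewrite xE; apply: generated_strip; apply: cov; first exact: dvdz_mull.
rewrite /degree_gap; have := sumn_strip d pp; have := sumn_strip a pp.
move: lt; rewrite xE; nia.
Qed.

Definition smaller (h h' : nat) (d d' a a' : seq nat) :=
  size d' <= size d /\ sumn d' + sumn a' + h' < sumn d + sumn a + h.

Definition covers_smaller h d a := forall h' d' a',
  smaller h h' d d' a a' -> admissible h' d' a' -> covers h' d' a'.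

(** In the last case one finds D(m) < A(m) < A(p) <= D(p) <= 2, so m divides a
weight b but no degree; this is absurd, because b does not divide h and
therefore divides some degree. *)
Lemma covers_prime_dvd h d a p : prime p -> p %| h -> size d <= 3 ->
  admissible h d a -> covers_smaller h d a -> covers h d a.
Proof.
move=> pp ph sz3 adm IH; have p1 := prime_gt1 pp.
have [h0 d0 a0 dom sz nd] := adm.
have hp : h %/ p < h by apply: ltn_Pdiv.
have [le|lt] := leqP (sumn (nonmults p d)) (sumn (nonmults p a)).
  apply: (covers_strip pp ph le); apply: IH; last exact: admissible_strip.
  split; first by rewrite size_map.
  by have := sumn_strip_le d pp; have := sumn_strip_le a pp; lia.
have restr m : mults m d < size d -> mults m d < mults m a ->
    sumn (nonmults m a) <= sumn (nonmults m d) -> covers h d a.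
  move=> md mm le; apply: (covers_restrict le); apply: IH.
    split; first by rewrite size_filter count_size.
    move: md; rewrite -sumn_nonmults_gt0 // (sumn_restrict m d) (sumn_restrict m a).
    lia.
  exact: admissible_restrict.
have pd : mults p d < size d by rewrite -sumn_nonmults_gt0 //; lia.
have [pa|pa] := ltnP (mults p d) (mults p a); first by apply: (restr p) => //; lia.
have [/allP dom'|] := boolP (all (fun m => (m %| h %/ p) ||
    (mults m a <= mults m d)) (divisors h)).
  have nd' b : ~~ (b %| h) -> ~~ (b %| h %/ p).
    by apply: contraNN => /dvdn_trans; apply; apply: dvdn_div.
  suff cov : covers (h %/ p) d a.
    move=> x hx; apply: cov; apply: dvdz_trans hx.
    by rewrite dvdzE !absz_nat dvdn_div.
  apply: IH; first by split=> //; lia.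
  have hp0 : 0 < h %/ p by rewrite divn_gt0 ?prime_gt0 // dvdn_leq.
  apply: (Admissible hp0 d0 a0 _ sz (sub_all nd' nd)).
  move=> m mh; have [mh'|mh'] := boolP (m %| h); last exact: dom.
  by have := dom' m; rewrite -dvdn_divisors // (negPf mh) => /(_ mh').
case/allPn => m; rewrite -dvdn_divisors // negb_or -ltnNge => mh /andP[mhp mm].
have pm : p %| m.
  apply: contraNT mhp => pm; move: mh; rewrite -{1}(divnK ph) Gauss_dvdl //.
  by rewrite coprime_sym prime_coprime.
have ma := leq_mults a pm.
have [le|lt'] := leqP (sumn (nonmults m a)) (sumn (nonmults m d)).
  by apply: (restr m) => //; lia.
have mp : mults m a <> mults p a.
  move=> E; move: lt'; rewrite (eq_nonmults pm E).
  by have := leq_sumn_nonmults d pm; lia.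
have [b ba mb] := @mults_mem m a ltac:(lia).
have := leq_mults d mb; have := dom b (allP nd b ba).
by have := mults_gt0 ba (dvdnn b); lia.
Qed.

(** * The case h = 1: reduction modulo a prime *)

Lemma admissible1_ge2 d a : admissible 1 d a -> all (leq 2) a.
Proof.
case=> _ _ a0 _ _ nd; apply/allP => b ba.
by have := allP a0 b ba; have := allP nd b ba; rewrite dvdn1; lia.
Qed.

Lemma admissible1 d a : all (leq 1) d -> all (leq 2) a -> size d < size a ->
  (forall m, 1 < m -> mults m a <= mults m d) -> admissible 1 d a.
Proof.
move=> d0 a2 sz dom; split=> //.
- by apply: sub_all a2 => b; lia.
- move=> [|m]; last by rewrite dvdn1 => ?; apply: dom; lia.
  move=> _; suff -> : mults 0 a = 0 by [].
  by apply/eqP; rewrite -leqn0 leqNgt -has_count -all_predC; apply: sub_all a2 => b /=; rewrite dvd0n; lia.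
- by apply: sub_all a2 => b; rewrite dvdn1; lia.
Qed.

Lemma admissible1_strip d a p : prime p -> p \notin a -> admissible 1 d a ->
  admissible 1 (map (strip p) d) (map (strip p) a).
Proof.
move=> pp pa adm; have p1 := prime_gt1 pp; have a2 := admissible1_ge2 adm.
have [_ d0 a0 dom sz _] := adm.
apply: admissible1; first exact: strip_gt0.
- rewrite all_map; apply/allP => b ba /=; have := allP a2 b ba.
  rewrite /strip; case: ifP => // pb; have : b != p by apply: contraNneq pa => <-.
  move: pb => /dvdnP[k ->]; rewrite mulnK; last by lia.
  by case: k => [|[|k]]; rewrite ?mul1n ?eqxx.
- by rewrite !size_map.
- move=> m m1; rewrite !mults_strip //; case: ifP => _; apply: dom; rewrite dvdn1; nia.
Qed.

(** The idea of Johnson's formula for the Frobenius number, where all weights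
but b are divisible by p: x - l b is divisible by p for some l < p. The loss of
at most (p - 1) b is what leaving b out of the second sum pays for. *)
Lemma covers_strip_modulo d a b p : prime p -> ~~ (p %| b) ->
    sumn (nonmults p d) <= sumn (nonmults p a) ->
    covers 1 (map (strip p) d) (map (strip p) (b :: a)) ->
  covers 1 d (b :: a).
Proof.
move=> pp pb le cov x _; rewrite /degree_gap => lt; have p1 := prime_gt1 pp.
have cop : coprime b p by rewrite coprime_sym prime_coprime.
have [l lp /dvdzP[y yE]] := residue_coprime x (prime_gt0 pp) cop.
have -> : x = (p%:Z * y + (l * b)%N%:Z)%R by lia.
apply: generatedD; last by apply: generatedM; rewrite mem_head.
apply: generated_strip; apply: cov; first by rewrite dvd1z.
rewrite /degree_gap; have := sumn_strip d pp; have := sumn_strip (b :: a) pp.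
move: (sumn (map _ d)) (sumn (map _ (b :: a))) => sd sa.
rewrite /= pb /= => Ea Ed; move: lt => /= lt.
have lb : l * b <= (p - 1) * b by rewrite leq_mul2r; lia.
nia.
Qed.

(** If p itself is a weight, stripping would produce the weight 1. In that case
the weights b and p may be replaced by b p, so that the amplitude is at least
b p - b - p. Regularity survives: for m = p k dividing b p but neither b nor p,
D(m) = D(k) as p divides all degrees, and A(k) > A(m) because of b. *)
Lemma covers_common_prime d a p : prime p -> all (dvdn p) d -> d != [::] ->
  admissible 1 d a -> covers_smaller 1 d a -> covers 1 d a.
Proof.
move=> pp pd dn adm IH; have p1 := prime_gt1 pp; have [_ d0 a0 dom sz _] := adm.
have a2 := admissible1_ge2 adm.
have pa : mults p a < size a.
  apply: leq_ltn_trans (dom p _) _; first by rewrite dvdn1; lia.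
  exact: leq_ltn_trans (count_size _ _) sz.
have /allPn[b ba pb] : ~~ all (dvdn p) a by rewrite all_count; lia.
have pbE := perm_to_rem ba; set a' := rem b a in pbE.
apply: (covers_perm (perm_refl d) pbE).
have [pa'|pa'] := boolP (p \in a); last first.
  apply: (covers_strip_modulo pp pb).
    suff /eqP-> : nonmults p d == [::] by [].
    by rewrite -[_ == _]negbK -has_filter; apply/hasPn => c /(allP pd) /= ->.
  apply: (covers_perm (perm_refl _) (perm_map _ _)); first by rewrite perm_sym; exact: pbE.
  apply: IH; last exact: admissible1_strip.
  split; first by rewrite size_map.
  have pd0 : 0 < mults p d.
    by move: pd; rewrite all_count => /eqP->; rewrite lt0n size_eq0.
  rewrite ltn_add2r -addSn; apply: leq_add; last exact: sumn_strip_le.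
  exact: sumn_strip_lt.
have pa'' : p \in a'.
  move: pa'; rewrite (perm_mem pbE) inE => /orP[/eqP pE|//].
  by rewrite pE dvdnn in pb.
have prE := perm_to_rem pa''; set r := rem p a' in prE.
have aE : perm_eq a (b :: p :: r) by apply: perm_trans pbE _; rewrite perm_cons.
have cop : coprime b p by rewrite coprime_sym prime_coprime.
have b0 : 0 < b by exact: (allP a0).
have b2 : 1 < b by exact: (allP a2).
have le : sumn (b * p :: r) <= sumn d.
  apply: sumn_dominated => //.
    rewrite /=; apply/andP; split; first by rewrite (leq_trans b2) ?leq_pmulr ?prime_gt0.
    by move: a2; rewrite (perm_all _ aE) => /= /and3P[].
  move=> m m1; have /= domE := permP aE (dvdn m); rewrite /=.
  have [mb|mb] := boolP (m %| b).
    by apply: leq_trans (dom m m1); rewrite domE mb dvdn_mulr // leq_add2l leq_addl.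
  have [mp|mp] := boolP (m %| p).
    by apply: leq_trans (dom m m1); rewrite domE mp dvdn_mull // leq_addl.
  have [mbp|_] := boolP (m %| b * p); last first.
    by apply: leq_trans (dom m m1); rewrite domE addnA leq_addl.
  have pm : p %| m.
    apply: contraNT mb => pm; move: mbp; rewrite Gauss_dvdl //.
    by rewrite coprime_sym prime_coprime.
  move: (pm) => /dvdnP[k kE].
  have kb : k %| b by move: mbp; rewrite kE dvdn_pmul2r // prime_gt0.
  have k1 : ~~ (k %| 1).
    by apply: contraNN mp; rewrite dvdn1 kE => /eqP ->; rewrite mul1n.
  have -> : mults m d = mults k d.
    apply: eq_in_count => c cd; have pc := allP pd c cd.
    rewrite kE Gauss_dvd ?pc ?andbT // coprime_sym prime_coprime //.
    by apply: contraNN pb => /dvdn_trans; apply.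
  apply: leq_trans (dom k k1); rewrite (permP aE (dvdn k)) /= kb leq_add2l.
  apply: leq_trans (leq_addl _ _); apply: leq_mults.
  by rewrite kE dvdn_mulr.
move=> x _; rewrite /degree_gap => lt.
have pin : p \in b :: a' by rewrite inE pa'' orbT.
apply: (generated_two (mem_head b a') pin (prime_gt0 pp) cop).
apply: le_lt_trans lt; move: le; rewrite /= (perm_sumn prE) /=.
by clear; lia.
Qed.

(** * The case h = 1: removing a degree *)

Definition covers_fewer (d : seq nat) := forall h' d' a',
  size d' < size d -> admissible h' d' a' -> covers h' d' a'.

Definition coprime_part b n := n`_(\pi(b)^').

Lemma coprime_coprime_part b n : 0 < b -> coprime b (coprime_part b n).
Proof. by move=> b0; rewrite coprime_pi' ?part_gt0 ?part_pnat. Qed.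

Lemma dvdn_coprime_part b n m : 0 < b -> 0 < n -> m %| n -> coprime m b ->
  m %| coprime_part b n.
Proof.
move=> b0 n0 mn; have m0 := dvdn_gt0 n0 mn; rewrite coprime_sym coprime_pi' // => mb.
by rewrite -(part_pnat_id mb) partn_dvd.
Qed.

Lemma dvdn_mul_coprime_part b c n : 0 < c -> b %| c -> b %| n ->
  b * coprime_part c n %| n.
Proof.
move=> c0 bc bn; rewrite Gauss_dvd ?bn ?dvdn_part //.
exact: coprime_dvdl bc (coprime_coprime_part n c0).
Qed.

(** The hypothesis says that any m which would break regularity after the
removal of d1 and b is prime to b; such an m divides the part h of d1 prime to
b, and h-regularity ignores it. As b h divides d1, the loss of at most
(h - 1) b in x is paid for by the removal of d1. *)
Lemma covers_drop d1 d b a : admissible 1 (d1 :: d) (b :: a) -> b %| d1 ->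
    (forall m, m %| d1 -> ~~ (m %| b) ->
       mults m (d1 :: d) <= mults m (b :: a) -> coprime m b) ->
  covers_fewer (d1 :: d) -> covers 1 (d1 :: d) (b :: a).
Proof.
move=> adm bd1 HB IH; have [_ d0 a0 dom sz _] := adm.
have a2 := admissible1_ge2 adm.
have /andP[d10 d'0] : (0 < d1) && all (leq 1) d := d0.
have /andP[b0 a'0] : (0 < b) && all (leq 1) a := a0.
have /andP[b2 a'2] : (1 < b) && all (leq 2) a := a2.
pose h := coprime_part b d1.
have hb : coprime b h := coprime_coprime_part d1 b0.
have bhd : b * h %| d1 := dvdn_mul_coprime_part b0 (dvdnn b) bd1.
(* If a weight c divides h, then b c divides d1, and b c may replace b and c:
   nonnegativity of the new amplitude places x beyond the Frobenius number of
   b and c. *)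
have [/hasP[c ca ch]|nch] := boolP (has (fun c => c %| h) a).
  have cop : coprime b c := coprime_dvdr ch hb.
  have prE := perm_to_rem ca; set r := rem c a in prE.
  have bcd : b * c %| d1 by apply: dvdn_trans bhd; rewrite dvdn_pmul2l.
  have c2 := allP a'2 c ca; have c0 := allP a'0 c ca.
  have le : sumn (b * c :: r) <= sumn (d1 :: d).
    apply: sumn_dominated => //.
      rewrite /= (leq_trans b2) ?leq_pmulr //=.
      by move: a'2; rewrite (perm_all _ prE) => /= /andP[].
    move=> m m1; have domE : mults m (b :: a) = (m %| b) + ((m %| c) + mults m r).
      by rewrite /= (permP prE (dvdn m)).
    have [mb|mb] := boolP (m %| b).
      by apply: leq_trans (dom m m1); rewrite domE /= mb dvdn_mulr // leq_add2l leq_addl.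
    have [mc|mc] := boolP (m %| c).
      by apply: leq_trans (dom m m1); rewrite domE /= mc dvdn_mull // leq_addl.
    rewrite [mults m (b * c :: r)]/=.
    have [mbc|_] := boolP (m %| b * c); last first.
      by apply: leq_trans (dom m m1); rewrite domE addnA leq_addl.
    rewrite [_ + _](_ : _ = (mults m (b :: a)).+1); last first.
      by rewrite domE (negPf mb) (negPf mc).
    rewrite ltnNge; apply: contraNN mc => /(HB m (dvdn_trans mbc bcd) mb) mcop.
    by rewrite -(Gauss_dvdr _ mcop).
  move=> x _; rewrite /degree_gap => lt.
  have cin : c \in b :: a by rewrite inE ca orbT.
  apply: (generated_two (mem_head b a) cin c0 cop).
  apply: le_lt_trans lt; move: le; rewrite /= (perm_sumn prE) /=.
  by clear; lia.
have h0 : 0 < h by apply: part_gt0.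
have adm' : admissible h d a.
  split=> //; last by rewrite -all_predC in nch.
  move=> m mh; have m1 : ~~ (m %| 1) by apply: contraNN mh => /dvdn_trans; apply.
  have := dom m m1; rewrite /=.
  have [mb|mb] := boolP (m %| b); first by rewrite (dvdn_trans mb bd1) leq_add2l.
  have [md|_] := boolP (m %| d1); last by [].
  move=> _; have := HB m md mb; rewrite /= md (negPf mb) !add0n add1n.
  have [//|_] := leqP (mults m a) (mults m d).
  by move=> /(_ isT) cop; rewrite dvdn_coprime_part in mh.
move=> x _; rewrite /degree_gap => lt.
have [l lh hx] := residue_coprime x h0 hb.
have -> : x = ((x - (l * b)%N%:Z) + (l * b)%N%:Z)%R by rewrite subrK.
apply: generatedD; last by apply: generatedM; rewrite mem_head.
apply: (@generated_sub a); first by move=> c ca; rewrite inE ca orbT.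
apply: (IH h d a) => //; rewrite /degree_gap.
have le := dvdn_leq d10 bhd.
have lb : l * b + b <= b * h by rewrite -mulSnr mulnC leq_mul2l lh orbT.
by move: lt lb le; rewrite /=; clear; lia.
Qed.

(** Let w = gcd(k, l) and L = lcm(k, l). All multiples of w beyond L - k - l
are combinations of k and l, so k and l act as the weight w once
L - k - l + w has been subtracted from x; a further multiple of w makes x
divisible by the part of d1 prime to k l, as in [covers_drop]. *)
Lemma covers_glue d1 d k l a : admissible 1 (d1 :: d) (k :: l :: a) ->
    k %| d1 -> l %| d1 -> ~~ coprime k l ->
    (forall m, 1 < m -> m %| d1 -> ~~ (m %| k) -> ~~ (m %| l) ->
       mults m (d1 :: d) <= mults m a -> coprime m (k * l)) ->
    (forall c, c \in a -> c %| d1 -> ~~ coprime c (k * l)) ->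
  covers_fewer (d1 :: d) -> covers 1 (d1 :: d) (k :: l :: a).
Proof.
move=> adm kd ld kl HG Hc IH; have [_ d0 a0 dom sz _] := adm.
have a2 := admissible1_ge2 adm.
have /andP[d10 d'0] : (0 < d1) && all (leq 1) d := d0.
have /and3P[k0 l0 a'0] : [&& 0 < k, 0 < l & all (leq 1) a] := a0.
have kl0 : 0 < k * l by rewrite muln_gt0 k0.
pose h := coprime_part (k * l) d1; pose w := gcdn k l.
have h0 : 0 < h by apply: part_gt0.
have w0 : 0 < w by rewrite gcdn_gt0 k0.
have w1 : 1 < w by rewrite ltn_neqAle eq_sym kl.
have [s kE] : exists s, k = s * w by apply/dvdnP; apply: dvdn_gcdl.
have [t lE] : exists t, l = t * w by apply/dvdnP; apply: dvdn_gcdr.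
have t0 : 0 < t by rewrite lE muln_gt0 in l0; case/andP: l0.
have s0 : 0 < s by rewrite kE muln_gt0 in k0; case/andP: k0.
have st : coprime s t.
  by rewrite /coprime -(eqn_pmul2r w0) mul1n muln_gcdl -kE -lE.
have Ld : s * t * w %| d1.
  suff -> : s * t * w = lcmn k l by rewrite dvdn_lcm kd.
  by rewrite kE lE -muln_lcml (eqP (_ : lcmn s t == s * t)) // -(eqn_pmul2r (_ : 0 < gcdn s t)) ?gcdn_gt0 ?s0 // muln_lcm_gcd (eqP st) muln1.
have Lhd : (s * t * w) * h %| d1.
  apply: dvdn_mul_coprime_part => //.
  by rewrite kE lE; apply/dvdnP; exists w; ring.
have wh : coprime w h.
  apply: coprime_dvdl (coprime_coprime_part d1 kl0).
  by rewrite kE mulnAC dvdn_mull.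
have adm' : admissible h d (w :: a).
  split=> //.
  - by rewrite /= w0.
  - move=> m mh; have m1 : ~~ (m %| 1) by apply: contraNN mh => /dvdn_trans; apply.
    have := dom m m1; rewrite /= dvdn_gcd.
    have [mk|mk] /= := boolP (m %| k); last have [ml|ml] /= := boolP (m %| l).
    + rewrite (dvdn_trans mk kd) leq_add2l; by case: (m %| l).
    + by rewrite (dvdn_trans ml ld) leq_add2l.
    have [md|//] := boolP (m %| d1).
    have m2 : 1 < m.
      by move: m1; rewrite dvdn1 ltn_neqAle (dvdn_gt0 d10 md) eq_sym andbT.
    move=> _; have := HG m m2 md mk ml; rewrite /= md !add0n add1n.
    have [//|_] := leqP (mults m a) (mults m d).
    by move=> /(_ isT) cop; rewrite dvdn_coprime_part in mh.
  - rewrite /=; apply/andP; split.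
      apply: contraNN kl => wdh; rewrite -/(gcdn k l == 1) -/w.
      by move: wh; rewrite /coprime (gcdn_idPl wdh).
    apply/allP => c ca; apply/negP => ch.
    have /negP := Hc c ca (dvdn_trans ch (dvdn_part _ _)); apply.
    by rewrite coprime_sym; apply: coprime_dvdr ch (coprime_coprime_part d1 kl0).
move=> x _; rewrite /degree_gap => lt.
pose f : int := ((s * t)%N%:Z - s%:Z - t%:Z + 1)%R.
have [j jh hx] := residue_coprime (x - f * w%:Z)%R h0 wh.
have {hx}gy : generated (w :: a) (x - f * w%:Z - (j * w)%N%:Z)%R.
  apply: (IH h d) => //; rewrite /degree_gap.
  have le := dvdn_leq d10 Lhd.
  have le1 : j * w <= (h - 1) * w by rewrite leq_mul2r; apply/orP; right; clear -jh h0; lia.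
  have le2 : w <= s * t * w by rewrite leq_pmull ?muln_gt0 ?s0.
  have le3 : s * t * w + h * w <= s * t * w * h + w.
    by clear -h0 le2; nia.
  move: lt le le1 le3; rewrite /= /f {1}kE {1}lE mulnBl mul1n; clear -h0 w0.
  by nia.
have gw z : (f <= z)%R -> generated (k :: l :: a) (w%:Z * z)%R.
  move=> fz; apply: (@generated_scale w [:: s; t]).
    move=> b; rewrite !inE => /orP[/eqP->|/eqP->]; rewrite mulnC.
      by rewrite -kE; apply: generated_mem; rewrite mem_head.
    by rewrite -lE; apply: generated_mem; rewrite !inE eqxx orbT.
  apply: (@generated_two _ s t) => //; rewrite ?inE ?eqxx ?orbT //.
  by move: fz; rewrite /f; clear; lia.
suff split : forall y, generated (w :: a) y -> exists (i : nat) (z : int),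
    generated a z /\ y = ((i * w)%N%:Z + z)%R.
  have [i [z [gz yE]]] := split _ gy.
  have -> : x = (w%:Z * (f + j%:Z + i%:Z) + z)%R.
    have -> : x = ((x - f * w%:Z - (j * w)%N%:Z) + (f * w%:Z + (j * w)%N%:Z))%R by ring.
    by rewrite yE !PoszM; ring.
  apply: generatedD; first by apply: gw; clear; lia.
  by apply: generated_sub gz => c ca; rewrite !inE ca !orbT.
move=> y; elim=> [|b z]; first by exists 0, 0%R; split; [exact: generated0|].
rewrite inE => /orP[/eqP->|ba] _ [i [z' [gz ->]]].
  by exists i.+1, z'; split; rewrite // mulSn PoszD; ring.
by exists i, (z' + b%:Z)%R; split; [exact: generatedS|ring].
Qed.

(** * Three degrees: pairs of weights with a common factor *)

Lemma common_primeP m n : 0 < m -> ~~ coprime m n ->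
  exists p, [/\ prime p, p %| m & p %| n].
Proof.
move=> m0 mn; exists (pdiv (gcdn m n)); have pd := pdiv_dvd (gcdn m n).
have g0 : 0 < gcdn m n by rewrite gcdn_gt0 m0.
split; first by apply: pdiv_prime; rewrite ltn_neqAle eq_sym mn.
  exact: dvdn_trans pd (dvdn_gcdl m n).
exact: dvdn_trans pd (dvdn_gcdr m n).
Qed.

(** [private d1 d2 d3 k] is asymmetric on purpose: k divides the first degree
alone. *)
Definition private d1 d2 d3 k := [&& k %| d1, ~~ (k %| d2) & ~~ (k %| d3)].

Lemma privateC d1 d2 d3 k : private d1 d2 d3 k = private d1 d3 d2 k.
Proof. by rewrite /private [X in _ && X]andbC. Qed.

(** The induction hypothesis is packed with the pair, so that all of it can be
transported along permutations. *)
Record critical d1 d2 d3 a : Prop := Critical {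
  crit_adm : admissible 1 [:: d1; d2; d3] a;
  crit_prime : forall p, prime p -> mults p [:: d1; d2; d3] <= 2;
  crit_fewer : covers_fewer [:: d1; d2; d3];
  crit_smaller : covers_smaller 1 [:: d1; d2; d3] a }.

Lemma critical_perm d1 d2 d3 e1 e2 e3 a a' :
    perm_eq [:: d1; d2; d3] [:: e1; e2; e3] -> perm_eq a a' ->
  critical d1 d2 d3 a -> critical e1 e2 e3 a'.
Proof.
move=> pd pa [adm pr fw sm]; split; first exact: admissible_perm adm.
- by move=> p /pr; rewrite (permP pd).
- exact: fw.
- by move=> h' d' a''; rewrite /smaller -(perm_sumn pd) -(perm_sumn pa); apply: sm.
Qed.

Lemma perm_swap23 (d1 d2 d3 : nat) : perm_eq [:: d1; d2; d3] [:: d1; d3; d2].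
Proof. by rewrite perm_cons (perm_catC [:: d2] [:: d3]). Qed.

Lemma critical_swap23 d1 d2 d3 a : critical d1 d2 d3 a -> critical d1 d3 d2 a.
Proof. exact: critical_perm (perm_swap23 _ _ _) (perm_refl a). Qed.

Lemma critical_dom d1 d2 d3 a m : critical d1 d2 d3 a -> m != 1 ->
  mults m a <= (m %| d1) + ((m %| d2) + (m %| d3)).
Proof.
move=> cr m1; have := adm_dom (crit_adm cr) (_ : ~~ (m %| 1)).
by rewrite /= addn0 dvdn1; apply.
Qed.

Lemma critical_le2 d1 d2 d3 a p : critical d1 d2 d3 a -> prime p ->
  mults p a <= 2.
Proof.
move=> cr pp; apply: leq_trans (crit_prime cr pp); apply: (adm_dom (crit_adm cr)).
by rewrite dvdn1; case: p pp => [|[]].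
Qed.

Lemma critical_ge2 d1 d2 d3 a b : critical d1 d2 d3 a -> b \in a -> 1 < b.
Proof. by move=> cr; apply/allP: b; apply: admissible1_ge2 (crit_adm cr). Qed.

Lemma critical_gt0 d1 d2 d3 a : critical d1 d2 d3 a -> [/\ 0 < d1, 0 < d2 & 0 < d3].
Proof. by move=> /crit_adm/adm_d/and4P[]. Qed.

Lemma critical_dvd d1 d2 d3 a b : critical d1 d2 d3 a -> b \in a ->
  [|| b %| d1, b %| d2 | b %| d3].
Proof.
move=> cr ba; have b1 := critical_ge2 cr ba.
have : 0 < mults b a by apply: mults_gt0 ba _.
have := critical_dom cr (_ : b != 1); rewrite neq_ltn b1 orbT => /(_ isT).
by do 3!case: (b %| _) => //=; case: (mults b a).
Qed.

Lemma three_le2 d1 d2 d3 k l b r p : critical d1 d2 d3 (k :: l :: b :: r) ->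
  prime p -> p %| k -> p %| l -> p %| b -> False.
Proof. by move=> cr pp pk pl pb; have := critical_le2 cr pp; rewrite /= pk pl pb. Qed.

Lemma not_three d1 d2 d3 k l b r m : critical d1 d2 d3 (k :: l :: b :: r) ->
  1 < m -> m %| k -> m %| l -> m %| b -> False.
Proof.
move=> cr m1 mk ml mb; have pm := pdiv_dvd m.
by apply: (three_le2 cr (pdiv_prime m1)); apply: dvdn_trans pm _.
Qed.

(** A failure of the hypothesis of [covers_drop] is an m dividing d1, not prime
to b and not dividing b. A prime common to m and b divides at most two weights,
so m divides one weight only, hence d1 alone among the degrees, and this weight
is private to d1 and not prime to b. *)
Lemma covers_no_private_neighbour d1 d2 d3 b a :
    critical d1 d2 d3 (b :: a) -> b %| d1 ->
    ~~ has (fun k => private d1 d2 d3 k && ~~ coprime b k) a ->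
  covers 1 [:: d1; d2; d3] (b :: a).
Proof.
move=> cr bd /hasPn np; apply: covers_drop bd _ (crit_fewer cr); first exact: crit_adm cr.
move=> m md mb Dm; apply/negPn/negP => mcop.
have [d10 _ _] := critical_gt0 cr; have m0 := dvdn_gt0 d10 md.
have [p [pp pm pb]] := common_primeP m0 mcop.
have pa : mults p a <= 1 by have := critical_le2 cr pp; rewrite /= pb.
move: Dm; rewrite /= md (negPf mb) add0n add1n addn0 => Dm.
have [c ca mc] := mults_mem (leq_trans (ltn0Sn _) Dm).
have ma : mults m a <= 1 := leq_trans (leq_mults a pm) pa.
have : (m %| d2) + (m %| d3) <= 0 by exact: leq_trans Dm ma.
rewrite leqn0 addn_eq0 !eqb0 => /andP[md2 md3].
have ncop : ~~ coprime b c.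
  apply/negP => /(coprime_dvdl pb)/(coprime_dvdr (dvdn_trans pm mc)).
  by rewrite /coprime gcdnn => /eqP p1; rewrite p1 in pp.
have := np c ca; rewrite ncop andbT /private.
rewrite (contraNN (dvdn_trans mc) md2) (contraNN (dvdn_trans mc) md3) !andbT.
have cin : c \in b :: a by rewrite inE ca orbT.
have := critical_dvd cr cin.
by rewrite (negPf (contraNN (dvdn_trans mc) md2)) (negPf (contraNN (dvdn_trans mc) md3)) !orbF => ->.
Qed.

(** Weights private to d1 are viewed as the vertices of a graph, with an edge
between any two that are not coprime. The gcd along an edge divides two
degrees, d1 and one of d2 and d3; the latter is the colour of the edge, which
any prime dividing both ends detects. *)
Lemma edge_gcd d1 d2 d3 k l a p : critical d1 d2 d3 (k :: l :: a) ->
  prime p -> p %| k -> p %| l -> ~~ (p %| d3) -> gcdn k l %| d2.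
Proof.
move=> cr pp pk pl pd; have pg : p %| gcdn k l by rewrite dvdn_gcd pk.
have g1 : gcdn k l != 1.
  by apply: contraTneq pg => ->; rewrite dvdn1; case: p pp {pk pl pd} => [|[]].
have := critical_dom cr g1; rewrite /= dvdn_gcdl dvdn_gcdr.
rewrite (negPf (contraNN (dvdn_trans pg) pd)) addn0.
by case: (_ %| d2) => //; rewrite addn0; case: (_ %| d1).
Qed.

(** The two weights k and l are the only multiples of p, and d3 is the only
degree prime to p, so this is [covers_strip_modulo]. Privacy guarantees that p
is not a weight. From here on one may assume d3 > sumn r. *)
Lemma covers_edge_sum d1 d2 d3 k l b r p :
    critical d1 d2 d3 (k :: l :: b :: r) ->
    prime p -> p %| k -> p %| l -> ~~ (p %| d3) ->
    private d1 d2 d3 k -> private d1 d2 d3 l ->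
    d3 <= sumn r -> covers 1 [:: d1; d2; d3] (k :: l :: b :: r).
Proof.
move=> cr pp pk pl pd prk prl le.
have : mults p (b :: r) = 0.
  by have := critical_le2 cr pp; rewrite /= pk pl !add1n !ltnS leqn0 => /eqP.
rewrite /= => /eqP; rewrite addn_eq0 eqb0 => /andP[pb /eqP pr].
have gd2 := edge_gcd cr pp pk pl pd.
have pd2 : p %| d2 by apply: dvdn_trans gd2; rewrite dvdn_gcd pk.
have pd1 : p %| d1 by case/and3P: prk => /(dvdn_trans pk).
have pin : p \notin k :: l :: b :: r.
  have npr c : private d1 d2 d3 c -> p != c.
    by case/and3P => _ nc _; apply: contraNneq nc => <-.
  rewrite !inE !negb_or npr // npr //=; apply/andP; split.
    by apply: contraNneq pb => <-.
  by apply/negP => /mults_gt0 -/(_ p (dvdnn p)); rewrite pr.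
have pE : perm_eq (k :: l :: b :: r) (b :: k :: l :: r).
  by rewrite (perm_catCA [:: k; l] [:: b] r).
apply: (covers_perm (perm_refl _) pE); apply: (covers_strip_modulo pp pb).
  rewrite /= pd1 pd2 pd pk pl /= addn0; apply: leq_trans le _.
  suff -> : nonmults p r = r by [].
  apply/all_filterP; rewrite all_count -[X in _ == X](count_predC (dvdn p)).
  by rewrite pr add0n.
apply: (crit_smaller cr); last first.
  by apply: admissible1_strip pp _ (admissible_perm (perm_refl _) pE (crit_adm cr)); rewrite -(perm_mem pE).
split; first by rewrite size_map.
rewrite ltn_add2r -addSn; apply: leq_add; last first.
  by rewrite (perm_sumn pE); apply: sumn_strip_le.
by apply: sumn_strip_lt pp (adm_d (crit_adm cr)) _; rewrite /= pd1.
Qed.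

(** The condition on b makes (d1, d2; k, l, b) regular, and d3 outweighs what is
thrown away. *)
Lemma covers_edge_triple d1 d2 d3 k l b r p :
    critical d1 d2 d3 (k :: l :: b :: r) ->
    prime p -> p %| k -> p %| l -> ~~ (p %| d3) ->
    private d1 d2 d3 k -> private d1 d2 d3 l ->
    (b %| d2) || [&& b %| d1, gcdn k b %| d2 & gcdn l b %| d2] ->
  covers 1 [:: d1; d2; d3] (k :: l :: b :: r).
Proof.
move=> cr pp pk pl pd prk prl cond.
have [le|lt] := leqP d3 (sumn r); first exact: covers_edge_sum cr pp pk pl pd prk prl le.
have gd2 := edge_gcd cr pp pk pl pd.
have /andP[kd1 _] := prk; have /andP[ld1 _] := prl.
have /and4P[k2 l2 b2 _] := admissible1_ge2 (crit_adm cr).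
have [d10 d20 _] := critical_gt0 cr.
apply: (@covers_sub _ _ _ [:: d1; d2] [:: k; l; b]).
- by move=> c; rewrite !inE => /or3P[]/eqP->; rewrite eqxx ?orbT.
- by rewrite /degree_gap /=; move: lt; clear; lia.
apply: (crit_fewer cr) => //; apply: admissible1 => //=.
- by rewrite d10 d20.
- by rewrite k2 l2 b2.
move=> m m1; rewrite !addn0.
have n3 := not_three cr m1.
have kl2 : m %| k -> m %| l -> m %| d2.
  by move=> mk ml; apply: dvdn_trans gd2; rewrite dvdn_gcd mk.
have kb2 : m %| k -> m %| b -> m %| d2.
  move=> mk mb; case/orP: cond => [|/and3P[_ g _]]; first exact: dvdn_trans mb.
  by apply: dvdn_trans g; rewrite dvdn_gcd mk.
have lb2 : m %| l -> m %| b -> m %| d2.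
  move=> ml mb; case/orP: cond => [|/and3P[_ _ g]]; first exact: dvdn_trans mb.
  by apply: dvdn_trans g; rewrite dvdn_gcd ml.
have k1 : m %| k -> m %| d1 by move/dvdn_trans; apply.
have l1 : m %| l -> m %| d1 by move/dvdn_trans; apply.
have b12 : m %| b -> (m %| d1) || (m %| d2).
  move=> mb; case/orP: cond => [/(dvdn_trans mb)->|/and3P[/(dvdn_trans mb)-> _ _]] //.
  by rewrite orbT.
case: (boolP (m %| k)) n3 kl2 kb2 k1 => [_|_] n3 kl2 kb2 k1;
case: (boolP (m %| l)) n3 kl2 lb2 l1 => [_|_] n3 kl2 lb2 l1;
case: (boolP (m %| b)) n3 kb2 lb2 b12 => [_|_] n3 kb2 lb2 b12 //;
  rewrite ?(k1 isT) ?(l1 isT) ?(kl2 isT isT) ?(kb2 isT isT) ?(lb2 isT isT) //.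
- by case: (n3 isT isT isT).
- by move: (b12 isT); case: (m %| d1); case: (m %| d2).
Qed.

Lemma perm_to_third (k l b : nat) a : b \in a ->
  perm_eq (k :: l :: a) (k :: l :: b :: rem b a).
Proof. by move=> ba; rewrite !perm_cons perm_to_rem. Qed.

Lemma critical_covers_perm d1 d2 d3 a a' : perm_eq a a' ->
  critical d1 d2 d3 a ->
  (critical d1 d2 d3 a' -> covers 1 [:: d1; d2; d3] a') ->
  covers 1 [:: d1; d2; d3] a.
Proof.
move=> pa cr H; apply: (covers_perm (perm_refl _) pa); apply: H.
exact: critical_perm (perm_refl _) pa cr.
Qed.

(** The condition under which (d1, d2; k, l, b) inherits regularity. *)
Definition tied d1 d2 k l b :=
  (b %| d2) || [&& b %| d1, gcdn k b %| d2 & gcdn l b %| d2].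

Lemma covers_edge_tied d1 d2 d3 k l a p :
    critical d1 d2 d3 (k :: l :: a) ->
    prime p -> p %| k -> p %| l -> ~~ (p %| d3) ->
    private d1 d2 d3 k -> private d1 d2 d3 l ->
    has (tied d1 d2 k l) a ->
  covers 1 [:: d1; d2; d3] (k :: l :: a).
Proof.
move=> cr pp pk pl pd prk prl /hasP[b ba bt].
apply: (critical_covers_perm (perm_to_third k l ba) cr) => cr'.
exact: covers_edge_triple cr' pp pk pl pd prk prl bt.
Qed.

(** Any weight that is not tied and divides d1 shares a factor with k or l. An
m violating the hypothesis of [covers_glue] would divide a single further
weight, and that weight would be private to d1. *)
Lemma covers_only_edge d1 d2 d3 k l a p :
    critical d1 d2 d3 (k :: l :: a) ->
    prime p -> p %| k -> p %| l -> ~~ (p %| d3) ->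
    private d1 d2 d3 k -> private d1 d2 d3 l ->
    ~~ has (private d1 d2 d3) a ->
  covers 1 [:: d1; d2; d3] (k :: l :: a).
Proof.
move=> cr pp pk pl pd prk prl /hasPn npr.
have [t|/hasPn nt] := boolP (has (tied d1 d2 k l) a).
  exact: covers_edge_tied cr pp pk pl pd prk prl t.
have /andP[kd1 _] := prk; have /andP[ld1 _] := prl.
apply: (covers_glue (crit_adm cr) kd1 ld1 _ _ _ (crit_fewer cr)).
- apply/negP => /(coprime_dvdl pk)/(coprime_dvdr pl).
  by rewrite /coprime gcdnn => /eqP p1; rewrite p1 in pp.
- move=> m m1 md mk ml Dm; apply/negPn/negP => mcop.
  have [q [qp qm qkl]] := common_primeP (ltnW m1) mcop.
  have qa : mults q a <= 1.
    have := critical_le2 cr qp; move: qkl; rewrite Euclid_dvdM //= => /orP[]->.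
      by rewrite add1n ltnS; apply/leq_trans/leq_addl.
    by rewrite addnCA add1n ltnS; apply/leq_trans/leq_addl.
  move: Dm; rewrite /= md add1n addn0 => Dm.
  have [c ca mc] := mults_mem (leq_trans (ltn0Sn _) Dm).
  have : (m %| d2) + (m %| d3) <= 0.
    exact: leq_trans Dm (leq_trans (leq_mults a qm) qa).
  rewrite leqn0 addn_eq0 !eqb0 => /andP[md2 md3].
  have cin : c \in k :: l :: a by rewrite !inE ca !orbT.
  have := npr c ca; have := critical_dvd cr cin; rewrite /private.
  rewrite (negPf (contraNN (dvdn_trans mc) md2)).
  by rewrite (negPf (contraNN (dvdn_trans mc) md3)) !orbF => ->.
- move=> c ca cd1; apply: contraNN (nt c ca); rewrite coprimeMr => /andP[ck cl].
  by rewrite /tied cd1 gcdnC (eqP ck) gcdnC (eqP cl) dvd1n orbT.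
Qed.

Lemma proper_dvdn_leq m n : 0 < n -> m %| n -> m != n -> 2 * m <= n.
Proof.
move=> n0 /dvdnP[c E]; move: n0; rewrite E; case: c {E} => [|[|c]] //.
  by rewrite mul1n eqxx.
by move=> _ _; rewrite leq_mul2r orbT.
Qed.

(** The pair with degrees lcm(k, l) and gcd(k, l) b and weights k, l, b is
regular. Both degrees properly divide d1, because of the common factor of b and
c for the former and of the privacy of c for the latter; hence their sum is at
most d1. *)
Lemma covers_disjoint_edges d1 d2 d3 k l b c r p :
    critical d1 d2 d3 (k :: l :: b :: c :: r) ->
    prime p -> p %| k -> p %| l -> ~~ (p %| d3) ->
    private d1 d2 d3 k -> private d1 d2 d3 l ->
    private d1 d2 d3 b -> private d1 d2 d3 c -> ~~ coprime b c ->
  covers 1 [:: d1; d2; d3] (k :: l :: b :: c :: r).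
Proof.
move=> cr pp pk pl pd prk prl prb prc bc.
have [le|lt] := leqP d3 (sumn (c :: r)).
  exact: covers_edge_sum cr pp pk pl pd prk prl le.
have [d10 _ _] := critical_gt0 cr.
have /andP[kd1 _] := prk; have /andP[ld1 _] := prl.
have /andP[bd1 _] := prb; have /andP[cd1 /andP[cd2 cd3]] := prc.
have /and5P[k2 l2 b2 c2 _] := admissible1_ge2 (crit_adm cr).
have k0 := ltnW k2; have l0 := ltnW l2; have b0 := ltnW b2; have c0 := ltnW c2.
pose u := gcdn k l.
have u0 : 0 < u by rewrite gcdn_gt0 k0.
have Ld1 : lcmn k l %| d1 by rewrite dvdn_lcm kd1.
have L_neq : lcmn k l != d1.
  have [q [qp qb qc]] := common_primeP b0 bc.
  have qd1 : q %| d1 := dvdn_trans qb bd1.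
  apply/eqP => LE; have : q %| k * l.
    by apply: dvdn_trans qd1 _; rewrite -LE dvdn_lcm dvdn_mulr // dvdn_mull.
  have := critical_le2 cr qp; rewrite /= qb qc Euclid_dvdM //.
  by case: (q %| k); case: (q %| l).
have cop_u x : x \in b :: c :: r -> coprime u x.
  move=> xr; apply/negPn/negP => /(common_primeP u0)[q [qp]].
  rewrite dvdn_gcd => /andP[qk ql] qx; have := critical_le2 cr qp.
  have : 0 < mults q (b :: c :: r) := mults_gt0 xr qx.
  by rewrite [mults q (k :: _)]/= -/(mults q (b :: c :: r)) qk ql; case: (mults _ _).
have ubd1 : u * b %| d1.
  rewrite Gauss_dvd ?cop_u ?mem_head // bd1 andbT.
  exact: dvdn_trans (dvdn_gcdl k l) kd1.
have ub_neq : u * b != d1.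
  apply/eqP => E; have : c %| u * b by rewrite E.
  rewrite Gauss_dvdr; last by rewrite coprime_sym cop_u // !inE eqxx orbT.
  move=> cb; have c1 : c != 1 by rewrite neq_ltn c2 orbT.
  have := critical_dom cr c1; rewrite /= cb dvdnn cd1 (negPf cd2) (negPf cd3).
  by case: (c %| k); case: (c %| l).
have L2 := proper_dvdn_leq d10 Ld1 L_neq.
have ub2 := proper_dvdn_leq d10 ubd1 ub_neq.
apply: (@covers_sub _ _ _ [:: lcmn k l; u * b] [:: k; l; b]).
- by move=> x; rewrite !inE => /or3P[]/eqP->; rewrite eqxx ?orbT.
- by rewrite /degree_gap /=; move: lt L2 ub2; rewrite /=; clear; lia.
apply: (crit_fewer cr) => //; apply: admissible1 => //=.
- by rewrite lcmn_gt0 k0 l0 muln_gt0 u0 b0.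
- by rewrite k2 l2 b2.
move=> m m1; rewrite !addn0.
have n3 := not_three cr m1.
have kL : m %| k -> m %| lcmn k l by move/dvdn_trans; apply; apply: dvdn_lcml.
have lL : m %| l -> m %| lcmn k l by move/dvdn_trans; apply; apply: dvdn_lcmr.
have bu : m %| b -> m %| u * b by apply: dvdn_mull.
have klu : m %| k -> m %| l -> m %| u * b.
  by move=> mk ml; apply: dvdn_mulr; rewrite dvdn_gcd mk.
case: (boolP (m %| k)) n3 kL klu => [_|_] n3 kL klu;
case: (boolP (m %| l)) n3 lL klu => [_|_] n3 lL klu;
case: (boolP (m %| b)) n3 bu => [_|_] n3 bu //;
  rewrite ?(kL isT) ?(lL isT) ?(bu isT) ?(klu isT isT) ?addn1 //.
by case: (n3 isT isT isT).
Qed.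

(** The gcd divides two of the degrees, hence d1 and d3, so its primes do not
divide d2. *)
Lemma edge_other_colour d1 d2 d3 k j a : critical d1 d2 d3 (k :: j :: a) ->
  ~~ (gcdn k j %| d2) -> exists q, [/\ prime q, q %| k, q %| j & ~~ (q %| d2)].
Proof.
move=> cr nd; have k2 : 1 < k by apply: (critical_ge2 cr); rewrite mem_head.
have ncop : ~~ coprime k j by apply: contraNN nd => /eqP->; rewrite dvd1n.
have [q [qp qk qj]] := common_primeP (ltnW k2) ncop.
exists q; split=> //; apply: contraNN (nd) => qd2.
have qg : q %| gcdn k j by rewrite dvdn_gcd qk.
have g1 : gcdn k j != 1 by apply: contraNneq nd => ->; rewrite dvd1n.
have := critical_dom cr g1; have := critical_dom cr (_ : q != 1).
have q1 : q != 1 by apply: contraTneq qp => ->.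
have := crit_prime cr qp; rewrite /= dvdn_gcdl dvdn_gcdr qd2 addn0.
have := @dvdn_trans _ _ d1 qg; have := @dvdn_trans _ _ d3 qg.
case: (gcdn k j %| d2) => //; case: (gcdn k j %| d1); last first.
  by case: (gcdn k j %| d3).
case: (gcdn k j %| d3) => // /(_ isT)-> /(_ isT)->.
by [].
Qed.

(** The edges k l and k j have different colours, so what holds for one holds
for the other with the roles of d2 and d3 exchanged.
If nothing is tied, every weight divides d1 alone, and a fourth weight b has a
factor in common with j, or else with both k and l: either way there are two
disjoint edges. *)
Lemma covers_all_private d1 d2 d3 k l j r p :
    critical d1 d2 d3 (k :: l :: j :: r) ->
    prime p -> p %| k -> p %| l -> ~~ (p %| d3) ->
    private d1 d2 d3 k -> private d1 d2 d3 l -> private d1 d2 d3 j ->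
    ~~ (gcdn k j %| d2) ->
  covers 1 [:: d1; d2; d3] (k :: l :: j :: r).
Proof.
move=> cr pp pk pl pd prk prl prj kjd2.
have [t|/hasPn nt] := boolP (has (tied d1 d2 k l) (j :: r)).
  exact: covers_edge_tied cr pp pk pl pd prk prl t.
have klj : perm_eq (k :: l :: j :: r) (k :: j :: l :: r).
  by rewrite perm_cons (perm_catCA [:: l] [:: j] r).
have crj := critical_perm (perm_refl _) klj cr.
have [q [qp qk qj qd2]] := edge_other_colour crj kjd2.
have crj' := critical_swap23 crj.
have cov' : covers 1 [:: d1; d3; d2] (k :: j :: l :: r) ->
    covers 1 [:: d1; d2; d3] (k :: l :: j :: r).
  exact: covers_perm (perm_swap23 d1 d2 d3) klj.
have prk' := prk; have prl' := prl; have prj' := prj.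
rewrite privateC in prk'; rewrite privateC in prl'; rewrite privateC in prj'.
have [t|/hasPn nt'] := boolP (has (tied d1 d3 k j) (l :: r)).
  by apply: cov'; apply: covers_edge_tied crj' qp qk qj qd2 prk' prj' t.
case: r cr klj crj crj' cov' nt nt' => [|b r] cr klj crj crj' cov' nt nt'.
  by have := adm_size (crit_adm cr).
have bin : b \in k :: l :: j :: b :: r by rewrite !inE eqxx !orbT.
have := nt b; rewrite !inE eqxx !orbT => /(_ isT); rewrite /tied negb_or => /andP[bd2 nb].
have := nt' b; rewrite !inE eqxx !orbT => /(_ isT); rewrite /tied negb_or => /andP[bd3 nb'].
have bd1 : b %| d1 by have := critical_dvd cr bin; rewrite (negPf bd2) (negPf bd3) !orbF.
have prb : private d1 d2 d3 b by rewrite /private bd1 bd2.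
rewrite bd1 /= in nb nb'.
have [jb|jb] := boolP (coprime j b); last first.
  exact: covers_disjoint_edges cr pp pk pl pd prk prl prj prb jb.
rewrite (eqP jb) dvd1n andbT in nb'.
have kbp : perm_eq (k :: l :: j :: b :: r) (k :: b :: l :: j :: r).
  by rewrite perm_cons (perm_catCA [:: l; j] [:: b] r).
have crb := critical_swap23 (critical_perm (perm_refl _) kbp cr).
have [s [sp sk sb sd3]] := edge_other_colour crb nb'.
rewrite (edge_gcd (critical_swap23 crb) sp sk sb sd3) /= in nb.
have lb : ~~ coprime l b by apply: contraNN nb => /eqP->; rewrite dvd1n.
apply: cov'; rewrite privateC in prb.
exact: covers_disjoint_edges crj' qp qk qj qd2 prk' prj' prl' prb lb.
Qed.

Lemma covers_edge d1 d2 d3 k l a p :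
    critical d1 d2 d3 (k :: l :: a) ->
    prime p -> p %| k -> p %| l -> ~~ (p %| d3) ->
    private d1 d2 d3 k -> private d1 d2 d3 l ->
  covers 1 [:: d1; d2; d3] (k :: l :: a).
Proof.
move=> cr pp pk pl pd prk prl.
have [/hasP[j ja prj]|npr] := boolP (has (private d1 d2 d3) a); last first.
  exact: covers_only_edge cr pp pk pl pd prk prl npr.
have [t|/hasPn nt] := boolP (has (tied d1 d2 k l) a).
  exact: covers_edge_tied cr pp pk pl pd prk prl t.
have := nt j ja; have /andP[jd1 _] := prj.
rewrite /tied negb_or jd1 /= negb_and => /andP[_ /orP[kj|lj]].
  apply: (critical_covers_perm (perm_to_third k l ja) cr) => cr'.
  exact: covers_all_private cr' pp pk pl pd prk prl prj kj.
have pE : perm_eq (k :: l :: a) (l :: k :: j :: rem j a).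
  apply: perm_trans (perm_to_third k l ja) _.
  by rewrite (perm_catCA [:: k] [:: l]).
apply: (critical_covers_perm pE cr) => cr'.
exact: covers_all_private cr' pp pl pk pd prl prk prj lj.
Qed.

Lemma covers_from_private d1 d2 d3 k a :
    critical d1 d2 d3 (k :: a) -> private d1 d2 d3 k ->
  covers 1 [:: d1; d2; d3] (k :: a).
Proof.
move=> cr prk; have /andP[kd1 _] := prk.
have [/hasP[l la /andP[prl kl]]|np] :=
  boolP (has (fun l => private d1 d2 d3 l && ~~ coprime k l) a); last first.
  exact: covers_no_private_neighbour cr kd1 np.
have k2 : 1 < k by apply: (critical_ge2 cr); rewrite mem_head.
have [p [pp pk pl]] := common_primeP (ltnW k2) kl.
have pE : perm_eq (k :: a) (k :: l :: rem l a) by rewrite perm_cons perm_to_rem.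
apply: (critical_covers_perm pE cr) => cr'.
have [pd3|pd3] := boolP (p %| d3); last first.
  exact: covers_edge cr' pp pk pl pd3 prk prl.
have pd2 : ~~ (p %| d2).
  have := crit_prime cr pp; rewrite /= pd3 (dvdn_trans pk kd1).
  by case: (p %| d2).
apply: (covers_perm (perm_swap23 _ _ _) (perm_refl _)).
rewrite privateC in prk; rewrite privateC in prl.
exact: covers_edge (critical_swap23 cr') pp pk pl pd2 prk prl.
Qed.

Lemma covers_from_dvd d1 d2 d3 b a :
    critical d1 d2 d3 (b :: a) -> b %| d1 ->
  covers 1 [:: d1; d2; d3] (b :: a).
Proof.
move=> cr bd1.
have [/hasP[k ka /andP[prk _]]|np] :=
  boolP (has (fun k => private d1 d2 d3 k && ~~ coprime b k) a); last first.
  exact: covers_no_private_neighbour cr bd1 np.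
have pE : perm_eq (b :: a) (k :: b :: rem k a).
  apply: (perm_trans (y := b :: k :: rem k a)); first by rewrite perm_cons perm_to_rem.
  by rewrite (perm_catCA [:: b] [:: k]).
by apply: (critical_covers_perm pE cr) => cr'; apply: covers_from_private.
Qed.

(** The argument starts from any weight b and any degree that it divides: if
[covers_drop] does not apply, b has a private neighbour k, which in turn has a
private neighbour l. *)
Lemma covers_critical d1 d2 d3 a : critical d1 d2 d3 a ->
  covers 1 [:: d1; d2; d3] a.
Proof.
case: a => [|b a] cr; first by have := adm_size (crit_adm cr).
have := critical_dvd cr (mem_head b a).
case/or3P => bd; first exact: covers_from_dvd.
  have pd : perm_eq [:: d1; d2; d3] [:: d2; d1; d3].
    by rewrite (perm_catCA [:: d1] [:: d2]).
  apply: (covers_perm pd (perm_refl _)); apply: covers_from_dvd bd.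
  exact: critical_perm pd (perm_refl _) cr.
have pd : perm_eq [:: d1; d2; d3] [:: d3; d1; d2].
  by rewrite (perm_catC [:: d1; d2] [:: d3]).
apply: (covers_perm pd (perm_refl _)); apply: covers_from_dvd bd.
exact: critical_perm pd (perm_refl _) cr.
Qed.

Lemma covers_two d1 d2 a : admissible 1 [:: d1; d2] a ->
    (forall p, prime p -> mults p [:: d1; d2] <= 1) ->
  covers_fewer [:: d1; d2] -> covers 1 [:: d1; d2] a.
Proof.
case: a => [|b a] adm pr fw; first by have := adm_size adm.
wlog bd1 : d1 d2 adm pr fw / b %| d1.
  move=> W; have b1 : ~~ (b %| 1) by have /andP[] := adm_ndvd adm.
  have := adm_dom adm b1; rewrite /= dvdnn.
  have [bd1 _|_] := boolP (b %| d1); first exact: W.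
  have [bd2 _|//] := boolP (b %| d2).
  have pd : perm_eq [:: d1; d2] [:: d2; d1] by rewrite (perm_catC [:: d1] [:: d2]).
  apply: (covers_perm pd (perm_refl _)); apply: W => //.
    exact: admissible_perm pd (perm_refl _) adm.
  by move=> p /pr; rewrite (permP pd).
apply: covers_drop (bd1) _ fw => // m md mb Dm.
have /andP[d10 _] := adm_d adm.
apply/negPn/negP => /(common_primeP (dvdn_gt0 d10 md))[p [pp pm pb]].
move: Dm; rewrite /= md (negPf mb) add0n add1n => Dm.
have p1 : ~~ (p %| 1) by rewrite dvdn1; case: p pp {pm pb} => [|[]].
have := leq_trans (adm_dom adm p1) (pr p pp); rewrite /= pb add1n ltnS leqn0 => /eqP pa.
by have := leq_trans Dm (leq_mults a pm); rewrite pa.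
Qed.

Theorem admissible_covers h d a : size d <= 3 -> admissible h d a -> covers h d a.
Proof.
have [C] := ubnP (size d); elim: C h d a => // C IHC h d a dC sz.
have [N] := ubnP (sumn d + sumn a + h).
elim: N h d a dC sz => // N IHN h d a dC sz dN adm.
have fw : covers_fewer d.
  move=> h' d' a' lt; apply: IHC; first exact: leq_trans lt dC.
  exact: leq_trans (ltnW lt) sz.
have sm : covers_smaller h d a.
  move=> h' d' a' [le lt]; apply: IHN; first exact: leq_ltn_trans le dC.
    exact: leq_trans le sz.
  exact: leq_trans lt dN.
have h0 := adm_h adm; have [h1|h1] := leqP h 1; last first.
  exact: covers_prime_dvd (pdiv_prime h1) (pdiv_dvd h) sz adm sm.
have {h0 h1} hE : h = 1 by apply/eqP; rewrite eqn_leq h1.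
rewrite hE in adm sm *; case: d => [|d1 d'] in dC sz dN adm fw sm *.
  case: a adm {dN sm} => [|b a] adm; first by have := adm_size adm.
  have /andP[b1 _] := adm_ndvd adm.
  by have := adm_dom adm b1; rewrite /= dvdnn.
have [/hasP[p pd1 pd]|/hasPn np] :=
    boolP (has (fun p => all (dvdn p) (d1 :: d')) (primes d1)).
  have pp : prime p by move: pd1; rewrite mem_primes => /and3P[].
  exact: covers_common_prime pp pd _ adm sm.
have /andP[d10 _] := adm_d adm.
have {}np p : prime p -> mults p (d1 :: d') <= size d'.
  move=> pp; have := np p; rewrite mem_primes pp d10 all_count.
  have := count_size (dvdn p) (d1 :: d'); rewrite leq_eqVlt => /orP[/eqP E|//].
  have : all (dvdn p) (d1 :: d') by rewrite all_count E.
  by case/andP => -> _ /(_ isT); rewrite E eqxx.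
case: d' => [|d2 [|d3 [|//]]] in dC sz dN adm fw sm np *.
- case: a adm {dN sm} => [|b a] adm; first by have := adm_size adm.
  have /andP[b1 _] := adm_ndvd adm; have /andP[b0 _] := adm_a adm.
  have := adm_dom adm b1; rewrite /= dvdnn addn0.
  case: (boolP (b %| d1)) => // bd1 _.
  have pp : prime (pdiv b) by apply: pdiv_prime; rewrite dvdn1 in b1; rewrite ltn_neqAle eq_sym b1.
  by have := np _ pp; rewrite /= (dvdn_trans (pdiv_dvd b) bd1).
- exact: covers_two.
- exact: covers_critical.
Qed.

(** * The theorem *)

Lemma mults_codom k (m : 'I_k -> nat) q :
  mults q (codom m) = #|[set i | q %| m i]|.
Proof.
rewrite count_map cardE {2}/enum_mem size_filter enumT.
by apply: eq_count => i; rewrite /= inE.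
Qed.

Lemma sumn_codom k (m : 'I_k -> nat) : sumn (codom m) = \sum_(i < k) m i.
Proof. by rewrite sumnE big_map big_enum. Qed.

(** Regularity is tested on the set of all weights divisible by m. *)
Lemma regular_dominated h c n (d : 'I_c -> nat) (a : 'I_n.+1 -> nat) : 0 < h ->
  (forall j, 0 < a j) -> regular h d a -> dominated h (codom d) (codom a).
Proof.
move=> h0 a0 reg m mh; rewrite !mults_codom.
set I := [set i | m %| a i].
have [->|I0] := eqVneq I set0; first by rewrite cards0.
have mI : m %| gcd_on a I.
  rewrite /gcd_on; elim/big_ind: _ => //= [x y mx my|i].
    by rewrite dvdn_gcd mx.
  by rewrite inE.
have gh : ~~ (gcd_on a I %| h) by apply: contraNN mh; apply: dvdn_trans.
have g1 : 1 < gcd_on a I.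
  rewrite ltn_neqAle; apply/andP; split.
    by apply: contraNneq gh => <-; apply: dvd1n.
  have /set0Pn[i iI] := I0.
  by rewrite /gcd_on (bigD1 i) //= gcdn_gt0 a0.
have [[p [pinj pd]]|gh'] := reg I I0 g1; last by rewrite gh' in gh.
rewrite -[#|I|]card_ord -(card_imset _ pinj); apply: subset_leq_card.
apply/subsetP => i /imsetP[j _ ->]; rewrite inE.
exact: dvdn_trans mI (pd j).
Qed.

Lemma generated_semigroup k (m : 'I_k -> nat) x :
  generated (codom m) x -> semigroup m x.
Proof.
elim=> [|b y /codomP[i ->] _ [l ->]].
  by exists (fun=> 0); rewrite big1 // => i _; rewrite mul0r.
exists (fun j => l j + (j == i)); rewrite [RHS](bigD1 i) //= (bigD1 i) //= eqxx.
rewrite [in RHS](eq_bigr (fun j => (l j)%:Z * (m j)%:Z)%R).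
  by rewrite /= (PoszD (l i)) mulrDl mul1r addrAC.
by move=> j /negPf ->; rewrite addn0.
Qed.

Lemma regular_gcd_all h c n (d : 'I_c -> nat) (a : 'I_n.+1 -> nat) :
  (forall j, 0 < a j) -> c <= n -> regular h d a -> gcd_all a %| h.
Proof.
move=> a0 cn reg; have gE : gcd_on a setT = gcd_all a.
  by apply: eq_bigl => i; rewrite inE.
have [g1|g1] := ltnP 1 (gcd_all a); last first.
  suff -> : gcd_all a = 1 by apply: dvd1n.
  apply/eqP; rewrite eqn_leq g1 /gcd_all (bigD1 ord0) //= gcdn_gt0 a0 //.
have T0 : [set: 'I_n.+1] != set0 by apply/set0Pn; exists ord0; rewrite inE.
rewrite -gE in g1 *; have [[p [pinj _]]|//] := reg setT T0 g1.
have := max_card (mem (codom p)); rewrite card_codom // !card_ord cardsT card_ord.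
by rewrite leqNgt ltnS cn.
Qed.

Local Open Scope ring_scope.

Theorem theorem1p4 (h c n : nat) (d : 'I_c -> nat) (a : 'I_n.+1 -> nat)
    (h_gt0 : (0 < h)%N)
    (d_gt0 : forall i : 'I_c, (0 < d i)%N)
    (a_gt0 : forall j : 'I_n.+1, (0 < a j)%N)
    (reg : regular h d a)
    (c_le3 : (c <= 3)%N)
    (c_len : (c <= n)%N)
    (a_ndvd : forall j : 'I_n.+1, ~~ (a j %| h)%N) :
  frobenius h a <= amplitude d a.
Proof.
have all_codom (P : pred nat) k (m : 'I_k -> nat) :
    (forall i, P (m i)) -> all P (codom m).
  by move=> Pm; apply/allP => _ /codomP[i ->].
have adm : admissible h (codom d) (codom a).
  split; rewrite ?size_codom ?card_ord //; try exact: all_codom.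
  exact: regular_dominated.
have cov : covers h (codom d) (codom a).
  by apply: admissible_covers adm; rewrite size_codom card_ord.
have gh : (gcd_all a %| h)%N by apply: regular_gcd_all reg.
have g0 : (0 < gcd_all a)%N by apply: dvdn_gt0 gh.
have ga i : (gcd_all a %| a i)%N by rewrite /gcd_all (bigD1 i) //= dvdn_gcdl.
have hg0 : (0 < h %/ gcd_all a)%N by rewrite divn_gt0 // dvdn_leq.
rewrite /frobenius (gcdn_idPl gh) /=; set g := gcd_all a in gh g0 ga hg0 *.
have [[hx nS] _] := frobenius_gaps_max hg0 (gcd_all_div g0).
rewrite -/g in hx nS; set x := max_int _ in hx nS *.
have -> : amplitude d a = degree_gap (codom d) (codom a).
  rewrite /amplitude /degree_gap !sumn_codom.
  by congr (_ - _); rewrite -natz natr_sum; apply: eq_bigr => i _; rewrite natz.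
rewrite leNgt; apply/negP => /cov gx.
have /generated_semigroup[l lE] : generated (codom a) (g%:Z * x).
  apply: gx; rewrite -(divnK gh) PoszM mulrC.
  by have /dvdzP[q ->] := hx; apply/dvdzP; exists q; ring.
apply: nS; exists l; apply: (@mulfI _ g%:Z); first by rewrite eqz_nat -lt0n.
rewrite lE mulr_sumr; apply: eq_bigr => i _.
by rewrite -{1}(divnK (ga i)) PoszM; ring.
Qed.
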